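(* For a solution $(q,u,p,\lambda)$ of the adjoint DAE system $$\dot q^i=f^i(q,u),\quad \dot p_j=-p_i\frac{\partial f^i}{\partial q^j}-\lambda_A\frac{\partial\phi^A}{\partial q^j},\quad 0=\phi^A(q,u),\quad 0=p_i\frac{\partial f^i}{\partial u^a}+\lambda_A\frac{\partial\phi^A}{\partial u^a},$$ and a solution $(q,u,\delta q,\delta u)$ of the variational equations $$\dot q^i=f^i(q,u),\quad 0=\phi^A(q,u),\quad \frac{d}{dt}\delta q^i=\frac{\partial f^i(q,u)}{\partial q^j}\delta q^j+\frac{\partial f^i(q,u)}{\partial u^a}\delta u^a,\quad 0=\frac{\partial\phi^A(q,u)}{\partial q^j}\delta q^j+\frac{\partial\phi^A(q,u)}{\partial u^a}\delta u^a,$$ covering the same curve $(q,u)$, one has $$\frac{d}{dt}\langle p(t),\delta q(t)\rangle=0.$$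
   Context: All manifolds and maps are smooth; the equations are written in local coordinates. $M_d$, $M_a$ are manifolds with local coordinates $q=(q^i)$, $u=(u^a)$; $\Phi\to M_d\times M_a$ is a vector bundle with dual $\Phi^*$; $\overline{TM}_d$ and $\overline{T^*M}_d$ are the pullbacks of $TM_d$ and $T^*M_d$ to $M_d\times M_a$ by the projection $M_d\times M_a\to M_d$. The base DAE $\dot q=f(q,u)$, $0=\phi(q,u)$ is specified by sections $f\in\Gamma(\overline{TM}_d)$, $\phi\in\Gamma(\Phi)$ (components $\phi^A$ in a local trivialization), and it is assumed that $D\phi$ has constant rank. $(q,u,p,\lambda)$ are coordinates on the Whitney sum $\overline{T^*M}_d\oplus\Phi^*$; the adjoint DAE system is the presymplectic Hamiltonian system $i_X\Omega_0=dH$ with $\Omega_0=dq^i\wedge dp_i$ and $H=\langle p,f(q,u)\rangle+\langle\lambda,\phi(q,u)\rangle$. $\langle p,\delta q\rangle=p_i\delta q^i$ is the pairing of $T_q^*M_d$ with $T_qM_d$. *)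

(* Defs.v *)
From HB Require Import structures.
From mathcomp Require Import all_boot all_order all_algebra.
From mathcomp Require Import all_classical all_reals all_analysis.

Set Implicit Arguments.
Unset Strict Implicit.
Unset Printing Implicit Defensive.

Import Order.TTheory GRing.Theory Num.Theory.
Import numFieldNormedType.Exports.

Local Open Scope classical_set_scope.
Local Open Scope ring_scope.

(* C^oo on an open set U of a finite-dimensional V: every iterated directional
   derivative of g, including g itself (vs = [::]), is differentiable on U. *)
Definition smooth_on (R : realType) (V W : normedModType R)
    (U : set V) (g : V -> W) : Prop :=
  forall (vs : seq V) (x : V), U x ->
    differentiable (foldr (fun v h => 'D_v h) g vs) x.

(* The values of coord off dom, and of icoord off coord @` dom, are junk. *)
Record chart (R : realType) (T : topologicalType) (n : nat) := Chart {
  dom : set T;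
  coord :> T -> 'rV[R]_n;
  icoord : 'rV[R]_n -> T;
  dom_open : open dom;
  image_open : open (coord @` dom);
  coordK : forall x, dom x -> icoord (coord x) = x;
  coord_continuous : forall x, dom x -> {for x, continuous coord};
  icoord_continuous : forall z, (coord @` dom) z -> {for z, continuous icoord}
}.

(* The atlas need not be maximal.  chart_at is a preferred chart around each
   point; it serves to model tangent spaces (see tangent). *)
Record manifold (R : realType) (n : nat) := Manifold {
  carrier :> topologicalType;
  carrier_hausdorff : hausdorff_space carrier;
  carrier_second_countable : @second_countable carrier;
  atlas : set (chart R carrier n);
  atlas_smooth : forall c c', atlas c -> atlas c' ->
    smooth_on (c @` (dom c `&` dom c')) (c' \o icoord c);
  chart_at : carrier -> chart R carrier n;
  chart_at_atlas : forall x, atlas (chart_at x);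
  chart_at_dom : forall x, dom (chart_at x) x
}.

Section TangentVectors.
Context {R : realType} {n : nat} {M : manifold R n}.

(* T_x M is R^n, a tangent vector being identified with its components in the
   preferred chart at x; its components in any other chart are obtained by the
   differential of the change of coordinates (tcoord). *)
Definition tangent (x : M) : Type := 'rV[R]_n.

HB.instance Definition _ (x : M) := GRing.Lmodule.on (tangent x).

Definition cotangent (x : M) := {linear tangent x -> R^o}.

(* The components v^i of v in the chart c around x. *)
Definition tcoord (c : chart R M n) (x : M) (v : tangent x) : 'rV[R]_n :=
  'd (c \o icoord (chart_at x)) (chart_at x x) (v : 'rV[R]_n).

(* The coordinate vector field d/dq^j of the chart c, at x. *)
Definition tframe (c : chart R M n) (x : M) (j : 'I_n) : tangent x :=
  'd (chart_at x \o icoord c) (c x) (delta_mx 0 j : 'rV[R]_n).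

(* The components p_j of p in the chart c around x. *)
Definition cocoord (c : chart R M n) (x : M) (p : cotangent x) : 'rV[R]_n :=
  \row_j p (tframe c x j).

End TangentVectors.

Section ProductCharts.
Context {R : realType} {nd na : nat}.
Context {Md : manifold R nd} {Ma : manifold R na}.

Definition prod_coord (c : chart R Md nd) (d : chart R Ma na) (b : Md * Ma) :
    'rV[R]_nd * 'rV[R]_na :=
  (c b.1, d b.2).

Definition prod_icoord (c : chart R Md nd) (d : chart R Ma na)
    (z : 'rV[R]_nd * 'rV[R]_na) : Md * Ma :=
  (icoord c z.1, icoord d z.2).

(* The part of W seen by the product chart (c, d), in coordinates. *)
Definition prod_image (c : chart R Md nd) (d : chart R Ma na)
    (W : set (Md * Ma)) : set ('rV[R]_nd * 'rV[R]_na) :=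
  prod_coord c d @` ((dom c `*` dom d) `&` W).

End ProductCharts.

(* Rank k vector bundles over Md x Ma.  triv indexes the local trivializations;
   tmap i b and tinv i b are mutually inverse only for b in tdom i.  The smooth
   structure of the total space is the one determined by the trivializations. *)
Record vbundle (R : realType) (nd na : nat)
    (Md : manifold R nd) (Ma : manifold R na) (k : nat) := VBundle {
  fiber :> Md * Ma -> lmodType R;
  triv : Type;
  tdom : triv -> set (Md * Ma);
  tmap : forall (i : triv) (b : Md * Ma), {linear fiber b -> 'rV[R]_k};
  tinv : forall (i : triv) (b : Md * Ma), {linear 'rV[R]_k -> fiber b};
  tdom_open : forall i, open (tdom i);
  tdom_cover : forall b, exists i, tdom i b;
  tmapK : forall i b, tdom i b -> cancel (tmap i b) (tinv i b);
  tinvK : forall i b, tdom i b -> cancel (tinv i b) (tmap i b);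
  transition_smooth : forall i j c d, atlas c -> atlas d ->
    forall v : 'rV[R]_k,
      smooth_on (prod_image c d (tdom i `&` tdom j))
        (fun z => tmap j (prod_icoord c d z) (tinv i (prod_icoord c d z) v))
}.

Section DAE.
Context {R : realType} {nd na k : nat}.
Context {Md : manifold R nd} {Ma : manifold R na} (Phi : vbundle Md Ma k).

(* Fibers of the dual bundle, and components in the dual local frame. *)
Definition dual_fiber (b : Md * Ma) := {linear Phi b -> R^o}.

Definition dual_coord (i : triv Phi) (b : Md * Ma) (l : dual_fiber b) :
    'rV[R]_k :=
  \row_A l (tinv i b (delta_mx 0 A)).

Definition partial_q (j : 'I_nd) (g : 'rV[R]_nd * 'rV[R]_na -> R^o)
    (z : 'rV[R]_nd * 'rV[R]_na) : R :=
  'D_((delta_mx 0 j, 0) : 'rV[R]_nd * 'rV[R]_na) g z.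

Definition partial_u (a : 'I_na) (g : 'rV[R]_nd * 'rV[R]_na -> R^o)
    (z : 'rV[R]_nd * 'rV[R]_na) : R :=
  'D_((0, delta_mx 0 a) : 'rV[R]_nd * 'rV[R]_na) g z.

(* f is a section of the pullback of TMd to Md x Ma. *)
Variable f : forall b : Md * Ma, tangent b.1.
Variable phi : forall b : Md * Ma, Phi b.

(* The local coordinate expressions of f^i and phi^A as functions of (q, u). *)
Definition f_loc (c : chart R Md nd) (d : chart R Ma na)
    (z : 'rV[R]_nd * 'rV[R]_na) : 'rV[R]_nd :=
  tcoord c (f (prod_icoord c d z)).

Definition phi_loc (c : chart R Md nd) (d : chart R Ma na) (T : triv Phi)
    (z : 'rV[R]_nd * 'rV[R]_na) : 'rV[R]_k :=
  tmap T (prod_icoord c d z) (phi (prod_icoord c d z)).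

Definition smooth_f : Prop := forall c d, atlas c -> atlas d ->
  smooth_on (prod_image c d setT) (f_loc c d).

Definition smooth_phi : Prop := forall c d T, atlas c -> atlas d ->
  smooth_on (prod_image c d (tdom T)) (phi_loc c d T).

Definition Dphi (c : chart R Md nd) (d : chart R Ma na) (T : triv Phi)
    (z : 'rV[R]_nd * 'rV[R]_na) : 'M[R]_(k, nd + na) :=
  row_mx (\matrix_(A, j) partial_q j (fun y => phi_loc c d T y 0 A) z)
         (\matrix_(A, a) partial_u a (fun y => phi_loc c d T y 0 A) z).

(* Off the zero set of phi, the rank of Dphi depends on the trivialization in
   which Dphi is computed; it is required to be constant in local
   trivializations whose domains cover Md x Ma. *)
Definition Dphi_constant_rank : Prop :=
  exists r : nat, forall b : Md * Ma, exists2 T : triv Phi, tdom T b &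
    forall c d, atlas c -> atlas d ->
      forall z, prod_image c d (tdom T) z -> \rank (Dphi c d T z) = r.

Section Curves.
Variable I : set R.

Definition smooth_curve (n : nat) (M : manifold R n) (x : R -> M) : Prop :=
  (forall t, I t -> {for t, continuous x}) /\
  forall c, atlas c -> smooth_on (I `&` x @^-1` dom c) (c \o x).

Definition smooth_tangent (n : nat) (M : manifold R n) (x : R -> M)
    (v : forall t, tangent (x t)) : Prop :=
  forall c, atlas c ->
    smooth_on (I `&` x @^-1` dom c) (fun t => tcoord c (v t)).

Definition smooth_cotangent (n : nat) (M : manifold R n) (x : R -> M)
    (p : forall t, cotangent (x t)) : Prop :=
  forall c, atlas c ->
    smooth_on (I `&` x @^-1` dom c) (fun t => cocoord c (p t)).

Definition smooth_dual (q : R -> Md) (u : R -> Ma)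
    (l : forall t, dual_fiber (q t, u t)) : Prop :=
  forall T : triv Phi,
    smooth_on (I `&` (fun t => (q t, u t)) @^-1` tdom T)
      (fun t => dual_coord T (l t)).

Record base_solution (q : R -> Md) (u : R -> Ma) : Prop := BaseSolution {
  base_smooth_q : smooth_curve q;
  base_smooth_u : smooth_curve u;
  base_ode : forall t c d, I t -> atlas c -> atlas d ->
    dom c (q t) -> dom d (u t) ->
    forall i, is_derive t (1 : R) (fun s => c (q s) 0 i : R^o)
                (f_loc c d (c (q t), d (u t)) 0 i);
  base_constraint : forall t c d T, I t -> atlas c -> atlas d ->
    dom c (q t) -> dom d (u t) -> tdom T (q t, u t) ->
    forall A, 0 = phi_loc c d T (c (q t), d (u t)) 0 A
}.

Record adjoint_solution (q : R -> Md) (u : R -> Ma)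
    (p : forall t, cotangent (q t))
    (lambda : forall t, dual_fiber (q t, u t)) : Prop := AdjointSolution {
  adjoint_base : base_solution q u;
  adjoint_smooth_p : smooth_cotangent p;
  adjoint_smooth_lambda : smooth_dual lambda;
  adjoint_ode : forall t c d T, I t -> atlas c -> atlas d ->
    dom c (q t) -> dom d (u t) -> tdom T (q t, u t) ->
    let z := (c (q t), d (u t)) in
    forall j, is_derive t (1 : R) (fun s => cocoord c (p s) 0 j : R^o)
      (- (\sum_(i < nd) cocoord c (p t) 0 i
              * partial_q j (fun y => f_loc c d y 0 i) z)
       - \sum_(A < k) dual_coord T (lambda t) 0 A
              * partial_q j (fun y => phi_loc c d T y 0 A) z);
  adjoint_constraint : forall t c d T, I t -> atlas c -> atlas d ->
    dom c (q t) -> dom d (u t) -> tdom T (q t, u t) ->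
    let z := (c (q t), d (u t)) in
    forall a,
      0 = \sum_(i < nd) cocoord c (p t) 0 i
              * partial_u a (fun y => f_loc c d y 0 i) z
        + \sum_(A < k) dual_coord T (lambda t) 0 A
              * partial_u a (fun y => phi_loc c d T y 0 A) z
}.

Record variational_solution (q : R -> Md) (u : R -> Ma)
    (dq : forall t, tangent (q t)) (du : forall t, tangent (u t)) : Prop :=
    VariationalSolution {
  variational_base : base_solution q u;
  variational_smooth_dq : smooth_tangent dq;
  variational_smooth_du : smooth_tangent du;
  variational_ode : forall t c d, I t -> atlas c -> atlas d ->
    dom c (q t) -> dom d (u t) ->
    let z := (c (q t), d (u t)) in
    forall i, is_derive t (1 : R) (fun s => tcoord c (dq s) 0 i : R^o)
      (\sum_(j < nd) partial_q j (fun y => f_loc c d y 0 i) z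
              * tcoord c (dq t) 0 j
       + \sum_(a < na) partial_u a (fun y => f_loc c d y 0 i) z
              * tcoord d (du t) 0 a);
  variational_constraint : forall t c d T, I t -> atlas c -> atlas d ->
    dom c (q t) -> dom d (u t) -> tdom T (q t, u t) ->
    let z := (c (q t), d (u t)) in
    forall A,
      0 = \sum_(j < nd) partial_q j (fun y => phi_loc c d T y 0 A) z
              * tcoord c (dq t) 0 j
        + \sum_(a < na) partial_u a (fun y => phi_loc c d T y 0 A) z
              * tcoord d (du t) 0 a
}.

End Curves.
End DAE.

(* Main.v *)
(* The rate of change of p_j dq^j can be computed in a single chart around
   q(t), because components of vectors and covectors transform by mutually
   inverse Jacobians.  By the product rule it is
     - l_A (D_j phi^A) dq^j + p_i (D_a f^i) du^a,
   the terms in D_j f^i cancelling.  The linearized constraint turns the first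
   summand into l_A (D_a phi^A) du^a, and the algebraic adjoint equation then
   says that the coefficient of du^a vanishes. *)

Require Import Defs.
From mathcomp Require Import all_boot all_order all_algebra.
From mathcomp Require Import all_classical all_reals all_analysis.

Import GRing.Theory numFieldNormedType.Exports.

Local Open Scope classical_set_scope.
Local Open Scope ring_scope.

Section ChangeOfChart.
Context {R : realType} {n : nat} {M : manifold R n}.
Implicit Types (c : chart R M n) (x : M).

Lemma transition_differentiable {c c' x} :
  atlas c -> atlas c' -> dom c x -> dom c' x ->
  differentiable (c' \o icoord c) (c x).
Proof.
move=> ac ac' cx c'x.
by apply: (@atlas_smooth _ _ M c c' ac ac' [::] (c x)); exists x.
Qed.

(** Continuity of [icoord c] at [c x] keeps [icoord c z] inside [dom c'] for [z] near [c x], so no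
    junk value is met. An identity of germs is what differentiation requires. *)
Lemma transitionK {c c' x} : dom c x -> dom c' x ->
  \forall z \near c x, c (icoord c' (c' (icoord c z))) = z.
Proof.
move=> cx c'x.
have imc : (c @` dom c) (c x) by exists x.
have nc' : \forall z \near c x, dom c' (icoord c z).
  apply: (icoord_continuous imc); rewrite (coordK cx).
  exact: open_nbhs_nbhs (conj (dom_open c') c'x).
have nc : \forall z \near c x, (c @` dom c) z.
  exact: open_nbhs_nbhs (conj (@image_open _ _ _ c) imc).
near=> z; have [y cy yz] : (c @` dom c) z by near: z.
rewrite coordK; last by near: z.
by rewrite -yz coordK.
Unshelve. all: by end_near. Qed.

(** Chain rule: the composite of the two transitions agrees with the identity near [c x]. *)
Lemma diff_transitionK {c c' x} (v : 'rV[R]_n) :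
  atlas c -> atlas c' -> dom c x -> dom c' x ->
  'd (c \o icoord c') (c' x) ('d (c' \o icoord c) (c x) v) = v.
Proof.
move=> ac ac' cx c'x.
have dcc' := transition_differentiable ac ac' cx c'x.
have dc'c := transition_differentiable ac' ac c'x cx.
have Ec'x : (c' \o icoord c) (c x) = c' x by rewrite /= coordK.
(* [diff_comp] takes the outer differential at the image point, so [c' x] is written in that
   form. *)
rewrite -Ec'x in dc'c *.
have := diff_comp dcc' dc'c => /(congr1 (fun h => h v)) /= <-.
rewrite -deriveE; last exact: differentiable_comp.
rewrite (near_eq_derive v (transitionK cx c'x)).
exact: derive_id.
Qed.

(** Expand [v] in the coordinate frame of [c]: [tframe] is the inverse Jacobian applied to the
    standard basis, and [tcoord] is the Jacobian itself. *)
Lemma pairing_coord c x (p : cotangent x) (v : tangent x) :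
  atlas c -> dom c x ->
  p v = \sum_(j < n) cocoord c p 0 j * tcoord c v 0 j.
Proof.
move=> ac cx.
have pZ (a : R) (w : 'rV[R]_n) : p (a *: w : 'rV[R]_n) = a * p w.
  exact: linearZ.
have pS (F : 'I_n -> 'rV[R]_n) : p (\sum_j F j) = \sum_j p (F j).
  exact: linear_sum.
have vE : v = \sum_(j < n) tcoord c v 0 j *: (tframe c x j : 'rV[R]_n).
  pose w : 'rV[R]_n := tcoord c v.
  have E : 'd (chart_at x \o icoord c) (c x) w = v.
    exact: diff_transitionK _ (chart_at_atlas x) ac (chart_at_dom x) cx.
  rewrite -[LHS]E [in LHS](row_sum_delta w) linear_sum.
  by apply: eq_bigr => j _; exact: linearZ.
rewrite [in LHS]vE pS; apply: eq_bigr => j _.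
by rewrite pZ mxE mulrC.
Qed.

End ChangeOfChart.

(** The pointwise algebra, with [fq], [fu], [gq], [gu] the partial Jacobians of f and phi; each
    summand has the shape given by the product rule. *)
Lemma adjoint_pairing_cancel {K : comPzRingType} {n m k : nat}
    (p v : 'I_n -> K) (w : 'I_m -> K) (l : 'I_k -> K)
    (fq : 'I_n -> 'I_n -> K) (fu : 'I_n -> 'I_m -> K)
    (gq : 'I_k -> 'I_n -> K) (gu : 'I_k -> 'I_m -> K) :
  (forall a, 0 = \sum_i p i * fu i a + \sum_A l A * gu A a) ->
  (forall A, 0 = \sum_j gq A j * v j + \sum_a gu A a * w a) ->
  \sum_j (p j * (\sum_i fq j i * v i + \sum_a fu j a * w a)
          + v j * (- (\sum_i p i * fq i j) - \sum_A l A * gq A j)) = 0.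
Proof.
move=> Hu Hg.
(* The algebraic adjoint equation contracted with [w]; [Sg] is the linearized constraint contracted
   with [l]. *)
have Su : \sum_i \sum_a p i * fu i a * w a + \sum_A \sum_a l A * gu A a * w a = 0.
  rewrite exchange_big [X in _ + X]exchange_big -big_split big1 // => a _ /=.
  by rewrite -!mulr_suml -mulrDl -Hu mul0r.
have Sg : \sum_A \sum_j l A * gq A j * v j + \sum_A \sum_a l A * gu A a * w a = 0.
  rewrite -big_split big1 // => A _ /=.
  under eq_bigr do rewrite -mulrA.
  under [X in _ + X]eq_bigr do rewrite -mulrA.
  by rewrite -!mulr_sumr -mulrDr -Hg mulr0.
have pE j : p j * (\sum_i fq j i * v i + \sum_a fu j a * w a)
    = \sum_i p j * fq j i * v i + \sum_a p j * fu j a * w a.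
  by rewrite mulrDr !mulr_sumr; congr (_ + _); apply: eq_bigr => ? _; rewrite mulrA.
have vE j : v j * (- (\sum_i p i * fq i j) - \sum_A l A * gq A j)
    = - (\sum_i p i * fq i j * v j) - \sum_A l A * gq A j * v j.
  by rewrite mulrC mulrBl mulNr !mulr_suml.
under eq_bigr do rewrite pE vE.
rewrite !big_split /= !sumrN [X in _ + (- X - _)]exchange_big.
rewrite [X in _ + (_ - X)]exchange_big addrACA subrr add0r.
(* The [fq] sums are gone; what is left is the difference of the first summands of [Su] and [Sg],
   whose second summands coincide. *)
by apply/eqP; rewrite subr_eq0; apply/eqP/(addIr _ (etrans Su (esym Sg))).
Qed.

Theorem proposition2p11 (R : realType) (nd na k : nat)
    (Md : manifold R nd) (Ma : manifold R na) (Phi : vbundle Md Ma k)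
    (f : forall b : Md * Ma, tangent b.1) (phi : forall b : Md * Ma, Phi b)
    (smooth_f_hyp : smooth_f f) (smooth_phi_hyp : smooth_phi phi)
    (rank_hyp : Dphi_constant_rank phi)
    (I : set R) (I_open : open I) (I_interval : is_interval I)
    (q : R -> Md) (u : R -> Ma)
    (p : forall t, cotangent (q t))
    (lambda : forall t, dual_fiber Phi (q t, u t))
    (dq : forall t, tangent (q t)) (du : forall t, tangent (u t))
    (adjoint_hyp : adjoint_solution f phi I p lambda)
    (variational_hyp : variational_solution f phi I dq du) :
  forall t : R, I t ->
    is_derive t (1 : R) (fun s => p s (dq s) : R^o) 0.
Proof.
move=> t It.
pose c := chart_at (q t); pose d := chart_at (u t).
have ac : atlas c := chart_at_atlas (q t).
have ad : atlas d := chart_at_atlas (u t).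
have cq : dom c (q t) := chart_at_dom (q t).
have cu : dom d (u t) := chart_at_dom (u t).
have [T Tt] := tdom_cover Phi (q t, u t).
have [q_cont _] := base_smooth_q (adjoint_base adjoint_hyp).
have near_c : \forall s \near t, dom c (q s).
  apply: (q_cont t It).
  exact: open_nbhs_nbhs (conj (dom_open c) cq).
(* The preferred chart at [q s] varies with [s]; near [t] the pairing is rewritten in the fixed
   chart [c], where the equations of motion apply. *)
have near_pairing : \forall s \near t,
    (\sum_(j < nd) ((fun s => cocoord c (p s) 0 j : R)
       * (fun s => tcoord c (dq s) 0 j : R))) s = p s (dq s) :> R^o.
  near=> s; rewrite fct_sumE; apply/esym/pairing_coord => //.
  by near: s.
apply: (near_eq_is_derive near_pairing).
apply: is_derive_eq.
  apply: is_derive_sum => j; apply: is_deriveM.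
    exact: (adjoint_ode adjoint_hyp It ac ad cq cu Tt j).
  exact: (variational_ode variational_hyp It ac ad cq cu j).
apply: (adjoint_pairing_cancel (fun j => cocoord c (p t) 0 j)
  (fun j => tcoord c (dq t) 0 j) (fun a => tcoord d (du t) 0 a)
  (fun A => dual_coord T (lambda t) 0 A)).
- exact: (adjoint_constraint adjoint_hyp It ac ad cq cu Tt).
- exact: (variational_constraint variational_hyp It ac ad cq cu Tt).
Unshelve. all: by end_near. Qed.
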